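(* Let $G_1=(V_1,E_1)$ and $G_2=(V_2,E_2)$ be graphs. Then $\mathrm{thin}(G_1\ast G_2)\leq \mathrm{indthin}(G_1\ast G_2)\leq \mathrm{indthin}(G_1)|V_2|\leq \mathrm{thin}(G_1)\chi(G_1)|V_2|$ and $\mathrm{pthin}(G_1\ast G_2)\leq \mathrm{indpthin}(G_1\ast G_2)\leq \mathrm{indpthin}(G_1)|V_2|\leq \mathrm{pthin}(G_1)\chi(G_1)|V_2|$.
   Context: Graphs are finite, simple, undirected; $\chi$ is the chromatic number. The co-normal (disjunctive) product $G_1\ast G_2$ has vertex set $V_1\times V_2$, and $(u_1,u_2)$, $(v_1,v_2)$ are adjacent iff $u_1v_1\in E_1$ or $u_2v_2\in E_2$. For a graph $G=(V,E)$, an ordering $v_1,\dots,v_n$ of $V$ and a partition of $V$ are consistent if for every $r<s<t$, whenever $v_r,v_s$ are in the same class and $v_tv_r\in E$, then $v_tv_s\in E$; strongly consistent if moreover for every $r<s<t$, whenever $v_s,v_t$ are in the same class and $v_tv_r\in E$, then $v_sv_r\in E$. $\mathrm{thin}(G)$ (resp. $\mathrm{pthin}(G)$) is the minimum number of classes of a partition of $V$ consistent (resp. strongly consistent) with some ordering of $V$; $\mathrm{indthin}$ (resp. $\mathrm{indpthin}$) is the same minimum when each class is additionally required to be an independent set. *)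

(* Defs.v *)
From HB Require Import structures.
From mathcomp Require Import all_boot.
Set Implicit Arguments.
Unset Strict Implicit.
Unset Printing Implicit Defensive.

Record sgraph := SGraph {
  vertex :> finType;
  adj : rel vertex;
  adj_sym : symmetric adj;
  adj_irr : irreflexive adj
}.

Definition conormal_adj (G1 G2 : sgraph) : rel (G1 * G2) :=
  fun u v => adj u.1 v.1 || adj u.2 v.2.

Lemma conormal_adj_sym (G1 G2 : sgraph) : symmetric (@conormal_adj G1 G2).
Proof. by move=> u v; rewrite /conormal_adj (adj_sym u.1) (adj_sym u.2). Qed.

Lemma conormal_adj_irr (G1 G2 : sgraph) : irreflexive (@conormal_adj G1 G2).
Proof. by move=> u; rewrite /conormal_adj !adj_irr. Qed.

Definition conormal (G1 G2 : sgraph) : sgraph :=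
  SGraph (@conormal_adj_sym G1 G2) (@conormal_adj_irr G1 G2).

Definition independent (G : sgraph) (A : {set G}) : bool :=
  [forall x in A, forall y in A, ~~ adj x y].

Definition proper_coloring (G : sgraph) k (c : {ffun G -> 'I_k}) : bool :=
  [forall x, forall y, adj x y ==> (c x != c y)].

Definition colorable (G : sgraph) : pred nat :=
  fun k => [exists c : {ffun G -> 'I_k}, proper_coloring c].

Lemma colorable_exists (G : sgraph) : exists k, colorable G k.
Proof.
exists #|G|; apply/existsP; exists [ffun x => enum_rank x].
apply/forallP=> x; apply/forallP=> y; apply/implyP=> xy; rewrite !ffunE.
by apply/eqP=> /enum_rank_inj exy; rewrite exy adj_irr in xy.
Qed.

Definition chi (G : sgraph) : nat := ex_minn (colorable_exists G).

(* An ordering v_1, ..., v_n of V(G), n = #|G|, indexed from 0: an injection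
   from 'I_n, hence a bijection. *)
Definition ordering (G : sgraph) (v : {ffun 'I_#|G| -> G}) : bool :=
  injectiveb v.

Definition same_class (G : sgraph) (P : {set {set G}}) (x y : G) : bool :=
  [exists C in P, (x \in C) && (y \in C)].

Definition consistent (G : sgraph) (v : {ffun 'I_#|G| -> G})
    (P : {set {set G}}) : bool :=
  [forall r : 'I_#|G|, forall s : 'I_#|G|, forall t : 'I_#|G|,
     [&& r < s, s < t, same_class P (v r) (v s) & adj (v t) (v r)]
       ==> adj (v t) (v s)].

Definition strongly_consistent (G : sgraph) (v : {ffun 'I_#|G| -> G})
    (P : {set {set G}}) : bool :=
  consistent v P &&
  [forall r : 'I_#|G|, forall s : 'I_#|G|, forall t : 'I_#|G|,
     [&& r < s, s < t, same_class P (v s) (v t) & adj (v t) (v r)]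
       ==> adj (v s) (v r)].

Definition indep_classes (G : sgraph) (P : {set {set G}}) : bool :=
  [forall C in P, independent C].

Definition is_thin (G : sgraph) : pred nat := fun k =>
  [exists P : {set {set G}}, exists v : {ffun 'I_#|G| -> G},
    [&& partition P [set: G], ordering v, consistent v P & #|P| == k]].

Definition is_pthin (G : sgraph) : pred nat := fun k =>
  [exists P : {set {set G}}, exists v : {ffun 'I_#|G| -> G},
    [&& partition P [set: G], ordering v, strongly_consistent v P & #|P| == k]].

Definition is_indthin (G : sgraph) : pred nat := fun k =>
  [exists P : {set {set G}}, exists v : {ffun 'I_#|G| -> G},
    [&& partition P [set: G], ordering v, consistent v P, indep_classes P
      & #|P| == k]].

Definition is_indpthin (G : sgraph) : pred nat := fun k =>
  [exists P : {set {set G}}, exists v : {ffun 'I_#|G| -> G},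
    [&& partition P [set: G], ordering v, strongly_consistent v P,
        indep_classes P & #|P| == k]].

(* The partition into singletons is strongly consistent with any ordering. *)
Lemma is_indpthin_exists (G : sgraph) : exists k, is_indpthin G k.
Proof.
pose P := [set [set x] | x : G]; exists #|P|.
pose v : {ffun 'I_#|G| -> G} := [ffun i => enum_val i].
have v_inj : injective v by move=> i j; rewrite !ffunE; apply: enum_val_inj.
have same x y : same_class P x y -> x = y.
  case/existsP=> C /andP[/imsetP[z _ ->]]; rewrite !inE.
  by case/andP=> /eqP-> /eqP->.
apply/existsP; exists P; apply/existsP; exists v; rewrite eqxx andbT.
apply/and4P; split.
- apply/and3P; split.
  + apply/eqP/setP=> x; rewrite inE; apply/bigcupP.
    by exists [set x]; rewrite ?imset_f ?set11.
  + apply/trivIsetP=> A B /imsetP[x _ ->] /imsetP[y _ ->] xy.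
    rewrite disjoints1 inE; apply: contra xy => /eqP->; exact: eqxx.
  + by apply/negP=> /imsetP[x _ /setP/(_ x)]; rewrite !inE eqxx.
- exact/injectiveP.
- apply/andP; split; do 3 (apply/forallP=> ?); apply/implyP.
    by case/and4P=> rs _ /same/v_inj e; rewrite e ltnn in rs.
  by case/and4P=> _ st /same/v_inj e; rewrite e ltnn in st.
- apply/forallP=> C; apply/implyP=> /imsetP[z _ ->].
  apply/forallP=> x; apply/implyP=> /set1P->.
  by apply/forallP=> y; apply/implyP=> /set1P->; rewrite adj_irr.
Qed.

Lemma is_indthin_exists (G : sgraph) : exists k, is_indthin G k.
Proof.
have [k /existsP[P /existsP[v /and5P[? ? /andP[? _] ? ?]]]] :=
  is_indpthin_exists G.
by exists k; apply/existsP; exists P; apply/existsP; exists v; apply/and5P.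
Qed.

Lemma is_pthin_exists (G : sgraph) : exists k, is_pthin G k.
Proof.
have [k /existsP[P /existsP[v /and5P[? ? ? _ ?]]]] := is_indpthin_exists G.
by exists k; apply/existsP; exists P; apply/existsP; exists v; apply/and4P.
Qed.

Lemma is_thin_exists (G : sgraph) : exists k, is_thin G k.
Proof.
have [k /existsP[P /existsP[v /and5P[? ? ? _ ?]]]] := is_indthin_exists G.
by exists k; apply/existsP; exists P; apply/existsP; exists v; apply/and4P.
Qed.

Definition thin (G : sgraph) : nat := ex_minn (is_thin_exists G).
Definition pthin (G : sgraph) : nat := ex_minn (is_pthin_exists G).
Definition indthin (G : sgraph) : nat := ex_minn (is_indthin_exists G).
Definition indpthin (G : sgraph) : nat := ex_minn (is_indpthin_exists G).

(* Main.v *)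
Require Import Defs.
From mathcomp Require Import all_boot.
Set Implicit Arguments.
Unset Strict Implicit.
Unset Printing Implicit Defensive.

(** An ordering with a partition is the same thing as an injective rank
    [f : G -> nat] with a labelling [c] of the vertices, the number of classes
    being the number of labels used. In this form both upper bounds come from
    pairing labels. Order [G1 * G2] lexicographically and label [(a, w)] by the
    label of [a] together with [w]. Two vertices [(a, w)], [(b, w)] with equal
    labels are then strictly ordered by their first coordinates, and a third
    vertex can tie with one of them in the first coordinate only if the
    adjacency in [G1] is inside a class, which independence rules out. For
    [thin G1 * chi G1], pair the labels of [G1] with a proper colouring. *)

(* All four parameters at once: [s] asks for strong consistency, [i] for
   independent classes. For each value of [s] and [i] this is convertible to the
   corresponding [is_thin], [is_pthin], [is_indthin] or [is_indpthin]. *)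
Definition is_gthin (s i : bool) (G : sgraph) : pred nat := fun k =>
  [exists P : {set {set G}}, exists v : {ffun 'I_#|G| -> G},
    [&& partition P [set: G], ordering v,
        (if s then strongly_consistent v P else consistent v P),
        i ==> indep_classes P & #|P| == k]].

(** Ranks are arbitrary distinct naturals, gaps allowed, so that an order on a product can be given
    by an arithmetic formula. *)
Record labelling (s i : bool) (G : sgraph) (T : finType)
    (f : G -> nat) (c : G -> T) : Prop := Labelling {
  rank_inj : injective f;
  label_consistent : forall x y z, f x < f y -> f y < f z -> c x = c y ->
    adj z x -> adj z y;
  label_strong : s -> forall x y z, f x < f y -> f y < f z -> c y = c z ->
    adj z x -> adj y x;
  label_indep : i -> forall x y, c x = c y -> ~~ adj x y
}.

(** Gaps are closed by sending [x] to the number of elements of smaller rank; [v] is the inverse of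
    this bijection. *)
Lemma rank_ordering (T : finType) (f : T -> nat) : injective f ->
  exists2 v : {ffun 'I_#|T| -> T}, injective v &
    forall r s : 'I_#|T|, (r < s) = (f (v r) < f (v s)).
Proof.
move=> f_inj; pose below x := [set y | f y < f x].
have rankP x : #|below x| < #|T|.
  rewrite -cardsT; apply: proper_card; apply/properP.
  split; first exact: subsetT.
  by exists x; rewrite !inE ?ltnn.
pose g x := Ordinal (rankP x).
have g_mono x y : f x < f y -> g x < g y.
  move=> xy; apply: proper_card; apply/properP; split.
    by apply/subsetP=> z; rewrite !inE => /ltn_trans; apply.
  by exists x; rewrite !inE ?ltnn.
have g_lt x y : (g x < g y) = (f x < f y).
  case: (ltngtP (f x) (f y)) => [/g_mono->//|/g_mono/ltnW|/f_inj->].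
    by rewrite leqNgt => /negbTE.
  exact: ltnn.
have g_inj : injective g.
  move=> x y gxy; apply: f_inj.
  by case: (ltngtP (f x) (f y)) => // /g_mono; rewrite gxy ltnn.
have [h gK hK] : bijective g by apply: inj_card_bij; rewrite ?card_ord.
exists (finfun h) => [r s|r s]; rewrite !ffunE; first exact: (can_inj hK).
by rewrite -g_lt !hK.
Qed.

Lemma label_partition (G : sgraph) (T : finType) (c : G -> T) :
  exists P : {set {set G}}, [/\ partition P [set: G],
    #|P| <= #|c @: [set: G]| & forall x y, same_class P x y = (c x == c y)].
Proof.
(* Fibres are taken only over labels that occur, since a partition has no empty class. *)
pose fib t := [set x | c x == t]; exists (fib @: (c @: [set: G])); split.
- apply/and3P; split.
  + apply/eqP/setP=> x; rewrite inE; apply/bigcupP.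
    by exists (fib (c x)); rewrite ?inE // !imset_f ?inE.
  + apply/trivIsetP=> _ _ /imsetP[t _ ->] /imsetP[u _ ->] tu.
    rewrite -setI_eq0; apply/eqP/setP=> x; rewrite !inE.
    apply/negP=> /andP[/eqP ct /eqP cu].
    by rewrite -ct -cu eqxx in tu.
  + apply/negP=> /imsetP[_ /imsetP[x _ ->] /setP/(_ x)].
    by rewrite !inE eqxx.
- exact: leq_imset_card.
- move=> x y; apply/existsP/eqP => [[_ /andP[/imsetP[t _ ->]]]|cxy].
    by rewrite !inE => /andP[/eqP-> /eqP->].
  by exists (fib (c x)); rewrite !imset_f ?inE //= cxy !eqxx.
Qed.

Lemma is_gthin_labelling (s i : bool) (G : sgraph) (T : finType)
    (f : G -> nat) (c : G -> T) : labelling s i f c ->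
  exists2 k, is_gthin s i G k & k <= #|c @: [set: G]|.
Proof.
case=> f_inj fc fs fi.
have [v v_inj v_lt] := rank_ordering f_inj.
have [P [partP cardP sameP]] := label_partition c.
exists #|P| => //; apply/existsP; exists P; apply/existsP; exists v.
have consv : consistent v P.
  do 3 (apply/forallP=> ?); apply/implyP; rewrite sameP !v_lt.
  by case/and4P=> rs st /eqP; apply: fc.
apply/and5P; split=> //; first exact/injectiveP.
  case: (boolP s) => // /fs fss; rewrite /strongly_consistent consv.
  do 3 (apply/forallP=> ?); apply/implyP; rewrite sameP !v_lt.
  by case/and4P=> rs st /eqP; apply: fss.
apply/implyP=> /fi fii; apply/forall_inP=> C CP.
apply/forall_inP=> x xC; apply/forall_inP=> y yC; apply: fii.
apply/eqP; rewrite -sameP; apply/existsP; exists C; exact/and3P.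
Qed.

Lemma same_class_pblock (G : sgraph) (P : {set {set G}}) (x y : G) :
  partition P [set: G] -> same_class P x y = (pblock P x == pblock P y).
Proof.
case/and3P=> /eqP covP tiP _.
rewrite eq_pblock ?covP ?inE //; apply/existsP/idP => [[C /and3P[CP xC]]|xy].
  by rewrite (def_pblock tiP CP xC).
by exists (pblock P x); rewrite xy pblock_mem ?mem_pblock ?covP ?inE.
Qed.

(** The rank of a vertex is its position in the ordering, and its label is its own class. *)
Lemma labelling_is_gthin (s i : bool) (G : sgraph) (k : nat) :
  is_gthin s i G k -> exists (f : G -> nat) (c : G -> {set G}),
    labelling s i f c /\ #|c @: [set: G]| <= k.
Proof.
case/existsP=> P /existsP[v /and5P[partP /injectiveP v_inj cons indP /eqP<-]].
have [g vK gK] : bijective v by apply: inj_card_bij; rewrite ?card_ord.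
have consv : consistent v P by case: (s) cons => // /andP[].
exists (fun x => nat_of_ord (g x)), (pblock P); split; last first.
  apply/subset_leq_card/subsetP=> _ /imsetP[x _ ->].
  by rewrite pblock_mem // (cover_partition partP) inE.
split.
- by move=> x y /val_inj/(can_inj gK).
- move=> x y z xy yz /eqP cxy zx.
  move/forallP/(_ (g x))/forallP/(_ (g y))/forallP/(_ (g z))/implyP: consv.
  by rewrite !gK same_class_pblock //; apply; exact/and4P.
- move=> ss x y z xy yz /eqP cyz zx; rewrite ss in cons.
  case/andP: cons => _.
  move/forallP/(_ (g x))/forallP/(_ (g y))/forallP/(_ (g z))/implyP.
  by rewrite !gK same_class_pblock //; apply; exact/and4P.
- move=> ii x y /eqP; rewrite -same_class_pblock // => /existsP[C].
  case/and3P=> CP xC yC.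
  move/implyP/(_ ii)/forall_inP/(_ C CP): indP.
  by move/forall_inP/(_ x xC)/forall_inP/(_ y yC).
Qed.

Lemma card_imset_pair (A T U : finType) (c : A -> T) (d : A -> U) :
  #|(fun x => (c x, d x)) @: [set: A]| <= #|c @: [set: A]| * #|U|.
Proof.
rewrite -(cardsT U) -cardsX; apply/subset_leq_card/subsetP=> _ /imsetP[x _ ->].
by rewrite in_setX in_setT andbT imset_f.
Qed.

(** Refining the labels preserves both consistency conditions, and vertices of equal colour are not
    adjacent. *)
Lemma labelling_coloring (s : bool) (G : sgraph) (T : finType) (m : nat)
    (f : G -> nat) (c : G -> T) (d : {ffun G -> 'I_m}) :
  proper_coloring d -> labelling s false f c ->
  labelling s true f (fun x => (c x, d x)).
Proof.
move=> dP [f_inj fc fs _]; split=> //.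
- by move=> x y z xy yz [cxy _]; apply: fc.
- by move=> /fs fss x y z xy yz [cyz _]; apply: fss.
- move=> _ x y [_ dxy]; apply/negP=> xy.
  by move/forallP/(_ x)/forallP/(_ y): dP; rewrite xy dxy eqxx.
Qed.

Lemma labelling_conormal (s : bool) (G1 G2 : sgraph) (T : finType)
    (f : G1 -> nat) (c : G1 -> T) : labelling s true f c ->
  @labelling s true (conormal G1 G2) (T * G2)%type
    (fun x => f x.1 * #|G2| + enum_rank x.2) (fun x => (c x.1, x.2)).
Proof.
case=> f_inj fc fs fi.
(* As [enum_rank z < #|G2|], the rank formula encodes the lexicographic order: the right side is
   below [(f b).+1 * #|G2|], and cancelling [#|G2|] leaves [f a < (f b).+1]. *)
have le1 (a b : G1) (w z : G2) : f a * #|G2| + enum_rank w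
    < f b * #|G2| + enum_rank z -> f a <= f b.
  move=> ab; rewrite -ltnS -(@ltn_pmul2r #|G2|); last first.
    exact: leq_ltn_trans (ltn_ord (enum_rank w)).
  apply: leq_ltn_trans (leq_addr (enum_rank w) _) _.
  by apply: ltn_trans ab _; rewrite mulSn addnC ltn_add2r.
have lt1 (a b : G1) (w : G2) : f a * #|G2| + enum_rank w
    < f b * #|G2| + enum_rank w -> f a < f b.
  by rewrite ltn_add2r ltn_mul2r => /andP[].
split.
- move=> [a w] [b z] /= e.
  have G2_gt0 : 0 < #|G2| by apply: leq_ltn_trans (ltn_ord (enum_rank w)).
  (* Division by [#|G2|] recovers the first coordinate's rank. *)
  have fab : f a = f b.
    have := congr1 (divn^~ #|G2|) e; rewrite !divnMDl //.
    by rewrite !divn_small ?ltn_ord // !addn0.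
  move/eqP: e; rewrite fab eqn_add2l => /eqP/val_inj/enum_rank_inj->.
  by rewrite (f_inj _ _ fab).
- move=> [a w] [b w'] [d z] /= xy /le1 bd [cab ww]; subst w'.
  move/lt1: xy => ab /orP[/= da|/= zw]; apply/orP; [left | by right].
  rewrite leq_eqVlt in bd; case/orP: bd => [/eqP/f_inj bd|bd /=].
    (* In a tie [b = d], the edge [da] would join [a] and [b], which have the same label. *)
    by move: (fi isT _ _ (esym cab)); rewrite bd da.
  exact: fc cab da.
- move=> /fs fss [a z] [b w] [d w'] /= /le1 ab yz [cbd ww]; subst w'.
  move/lt1: yz => bd /orP[/= da|/= wz]; apply/orP; [left | by right].
  rewrite leq_eqVlt in ab; case/orP: ab => [/eqP/f_inj ab|ab /=].
    (* Here the tie is [a = b], and [da] would join [b] and [d], again of equal label. *)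
    by move: (fi isT _ _ (esym cbd)); rewrite -ab da.
  exact: fss cbd da.
- move=> _ [a w] [b z] [cab /= <-]; rewrite /= /conormal_adj /= adj_irr orbF.
  exact: fi.
Qed.

Lemma is_gthin_conormal (s : bool) (G1 G2 : sgraph) (k : nat) :
  is_gthin s true G1 k ->
  exists2 j, is_gthin s true (conormal G1 G2) j & j <= k * #|G2|.
Proof.
case/labelling_is_gthin=> f [c [/(labelling_conormal G2)/is_gthin_labelling]].
case=> j jP jle ck; exists j => //; apply: leq_trans jle _.
apply: leq_trans (card_imset_pair (fun x : conormal G1 G2 => c x.1) snd) _.
rewrite leq_mul2r; apply/orP; right; apply: leq_trans ck.
(* Only an inclusion holds in general: for empty [G2] the left image is empty. *)
apply/subset_leq_card/subsetP=> _ /imsetP[x _ ->].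
by rewrite imset_f ?inE.
Qed.

Lemma is_gthin_chi (s : bool) (G : sgraph) (k : nat) :
  is_gthin s false G k ->
  exists2 j, is_gthin s true G j & j <= k * chi G.
Proof.
rewrite /chi; case: ex_minnP => m /existsP[d dP] _.
case/labelling_is_gthin=> f [c [/(labelling_coloring dP)/is_gthin_labelling]].
case=> j jP jle ck; exists j => //; apply: leq_trans jle _.
apply: leq_trans (card_imset_pair c d) _.
by rewrite card_ord leq_mul2r ck orbT.
Qed.

(** The construction is applied to the minimal witness of [q]; this reduces each inequality between
    parameters to a construction on partitions. *)
Lemma ex_minn_le (p q : pred nat) (ep : exists n, p n) (eq : exists n, q n)
    (h : nat -> nat) :
  (forall k, q k -> exists2 j, p j & j <= h k) -> ex_minn ep <= h (ex_minn eq).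
Proof.
move=> pq; case: (ex_minnP eq) => k /pq[j pj jk] _.
by case: ex_minnP => m _ /(_ j pj) mj; apply: leq_trans jk.
Qed.

Theorem theorem4p41 (G1 G2 : sgraph) :
  [/\ thin (conormal G1 G2) <= indthin (conormal G1 G2),
      indthin (conormal G1 G2) <= indthin G1 * #|G2|
    & indthin G1 * #|G2| <= thin G1 * chi G1 * #|G2|] /\
  [/\ pthin (conormal G1 G2) <= indpthin (conormal G1 G2),
      indpthin (conormal G1 G2) <= indpthin G1 * #|G2|
    & indpthin G1 * #|G2| <= pthin G1 * chi G1 * #|G2|].
Proof.
split; split.
- apply: (@ex_minn_le _ _ _ _ id) => k.
  case/existsP=> P /existsP[v /and5P[? ? ? _ ?]]; exists k => //.
  by apply/existsP; exists P; apply/existsP; exists v; apply/and4P.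
- apply: (@ex_minn_le _ _ _ _ (muln^~ #|G2|)) => k.
  exact: (@is_gthin_conormal false).
- rewrite leq_mul2r; apply/orP; right.
  apply: (@ex_minn_le _ _ _ _ (muln^~ (chi G1))) => k.
  exact: (@is_gthin_chi false).
- apply: (@ex_minn_le _ _ _ _ id) => k.
  case/existsP=> P /existsP[v /and5P[? ? ? _ ?]]; exists k => //.
  by apply/existsP; exists P; apply/existsP; exists v; apply/and4P.
- apply: (@ex_minn_le _ _ _ _ (muln^~ #|G2|)) => k.
  exact: (@is_gthin_conormal true).
- rewrite leq_mul2r; apply/orP; right.
  apply: (@ex_minn_le _ _ _ _ (muln^~ (chi G1))) => k.
  exact: (@is_gthin_chi true).
Qed.
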